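(* Let $T>0$ and let $\Delta t=T/N_t$ ($N_t\in\mathbb{N}^*$), $\Delta x>0$, $\Delta v>0$ satisfy $\Delta t\le\frac{\Delta v^2}{2}$. Let $\varphi_{\mathrm{in}}:\mathbb{R}\times\mathbb{R}\to\mathbb{R}$ and, with $\mu_{\mathrm{in},i}=\min_{j\in\mathbb{Z}}\overline{\varphi}_{\mathrm{in},i_j,j}$, assume that there exist constants $M>0$ and $L\ge0$ such that (a) $\left|\varphi_{\mathrm{in}}(x,v)-\frac{v^2}{2}\right|\le M$ for all $(x,v)\in\mathbb{R}^2$; (b) $\left|\mu_{\mathrm{in},i}+\varepsilon\ln(c^\varepsilon_{\Delta v})\right|\le M$ for all $i\in\mathbb{Z}$ and all $\varepsilon\in(0,1]$; (c) for all $v\in\mathbb{R}$, the function $x\mapsto\varphi_{\mathrm{in}}(x,v)-\frac{v^2}{2}$ is $L$-Lipschitz; (d) for all $x\in\mathbb{R}$, the function $v\mapsto\varphi_{\mathrm{in}}(x,v)-\frac{v^2}{2}$ is $L$-Lipschitz. Let $(\mu_i^n,\varphi_{ij}^n)$ be the solution of the scheme $$\mu_i^{n+1}=\min_{j\in\mathbb{Z}}\overline{\varphi}^{\,n}_{i_j,j},\qquad \varphi_{ij}^{n+1}=\min\left\{\overline{\varphi}^{\,n}_{i_j,j}+\Delta t,\ \frac{v_j^2}{2}+\mu_i^{n+1}\right\},\qquad (i,j)\in\mathbb{Z}^2,\ 0\le n\le N_t-1,$$ with $\mu_i^0=\mu_{\mathrm{in},i}$, $\varphi_{ij}^0=\varphi_{\mathrm{in}}(x_i,v_j)$,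 and let $\varphi$ be the viscosity solution of $(\mathcal{P}^0)$ given in the context. Then the scheme captures $\varphi$ when $\Delta t,\Delta x,\Delta v\to0$ under the conditions $\Delta t\le\Delta v^2/2$ and $\Delta x/\Delta t\to0$. More precisely, there exists a constant $C$, depending on the final time $T$ and on the velocity $v_j$ (and on the data $\varphi_{\mathrm{in}}$, but not otherwise on $\Delta t,\Delta x,\Delta v$), such that for all $(i,j)\in\mathbb{Z}^2$ $$\left|\varphi_{ij}^{N_t}-\varphi(T,x_i,v_j)\right|\le C\left(\Delta t+\frac{\Delta x}{\Delta t}+\Delta v\right).$$
   Context: Grid: $x_i=i\Delta x$, $v_j=j\Delta v$ for $i,j\in\mathbb{Z}$; $t^n=n\Delta t$. $c^\varepsilon_{\Delta v}=\sum_{j\in\mathbb{Z}}e^{-v_j^2/(2\varepsilon)}\Delta v$. Linear interpolation: for a family $u=(u_{ij})_{(i,j)\in\mathbb{Z}^2}$, set $\beta_j=\lfloor v_j\Delta t/\Delta x\rfloor$, $\alpha_j=v_j\Delta t/\Delta x-\beta_j\in[0,1)$, $i_j=i-\beta_j$, and $\overline{u}_{i_j,j}=(1-\alpha_j)u_{i_j,j}+\alpha_j u_{i_j-1,j}$, the linear interpolation of $(u_{ij})_i$ at $x_i-\Delta t\,v_j$. $\overline{\varphi}_{\mathrm{in},i_j,j}$ is this applied to $(\varphi_{\mathrm{in}}(x_i,v_j))_{ij}$ and $\overline{\varphi}^{\,n}_{i_j,j}$ to $(\varphi^n_{ij})_{ij}$. Limit problem $(\mathcal{P}^0)$ (dimension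 one in $x$ and $v$): $$\max\left(\partial_t\varphi+v\,\partial_x\varphi-1,\ \varphi-\min_{v}\varphi-\frac{v^2}{2}\right)=0,\quad \partial_t\left(\min_v\varphi\right)\le0,\quad \partial_t\left(\min_v\varphi\right)=0\ \text{ if }\ \operatorname{argmin}_v\varphi(t,x,v)=\{0\}.$$ Its viscosity solution (for the initial datum $\min\{\varphi_{\mathrm{in}},\min_{v}\varphi_{\mathrm{in}}+v^2/2\}$) is, by a known theorem (Bouin, Calvez, Grenier, Nadin, 2023), the function given for $t>0$ by the kinetic Hopf–Lax formula $$\varphi(t,x,v)=\inf_{\gamma}\left\{\varphi_{\mathrm{in}}(y,w^0)+\overline{A}_0^t[\gamma]\right\}.$$ The infimum is over all $\gamma=(y,\mathbf{s},\mathbf{w})$ consisting of a starting point $y\in\mathbb{R}$, an integer $N\ge0$, times $0=s^0<s^1<\dots<s^N\le t$, and velocities $w^0,\dots,w^N\in\mathbb{R}$ with $w^k\ne w^{k-1}$ for $1\le k\le N$, such that $w^N=v$ and, with $s^{N+1}=t$, $y+\sum_{k=0}^N(s^{k+1}-s^k)w^k=x$ (i.e. the piecewise linear curve with càdlàg velocity equal to $w^k$ between $s^k$ and $s^{k+1}$ ends at $x$ with velocity $v$). The action is $$\overline{A}_0^t[\gamma]=\frac12\sum_{k=1}^{N}|w^k|^2+\sum_{k=0}^{N}(s^{k+1}-s^k)\mathbf{1}_{w^k\ne0}.$$ This function may be taken as the definition of the viscosity solution. *)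

(* Defs.v *)
From HB Require Import structures.
From mathcomp Require Import all_boot all_order all_algebra.
From mathcomp Require Import all_classical all_reals all_analysis.
Export numFieldNormedType.Exports.

Set Implicit Arguments.
Unset Strict Implicit.
Unset Printing Implicit Defensive.

Import Order.TTheory GRing.Theory Num.Theory.

Local Open Scope classical_set_scope.
Local Open Scope ring_scope.

Definition grid {R : realType} (h : R) (k : int) : R := k%:~R * h.

(* The sum over Z is an [esum] of nonnegative terms; it is finite as soon as
   [0 < dv] and [0 < eps], so [fine] loses nothing. *)
Definition c_eps {R : realType} (dv eps : R) : R :=
  fine (\esum_(j in [set: int])
          (expR (- (grid dv j ^+ 2 / (2 * eps))) * dv)%:E).

(* [interp dt dx dv u i j] is the linear interpolation of [u ^~ j] at
   [grid dx i - dt * grid dv j]. *)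
Definition interp {R : realType} (dt dx dv : R) (u : int -> int -> R)
    (i j : int) : R :=
  let beta : int := Num.floor (grid dv j * dt / dx) in
  let alpha : R := grid dv j * dt / dx - beta%:~R in
  (1 - alpha) * u (i - beta) j + alpha * u (i - beta - 1) j.

(* [m] is the minimum (attained) of the family [f]. *)
Definition is_min {R : realType} {I : Type} (f : I -> R) (m : R) : Prop :=
  (exists j, f j = m) /\ (forall j, m <= f j).

Definition sample {R : realType} (dx dv : R) (f : R -> R -> R) (i j : int) : R :=
  f (grid dx i) (grid dv j).

Definition is_mu_in {R : realType} (dt dx dv : R) (phi_in : R -> R -> R)
    (mu_in : int -> R) : Prop :=
  forall i, is_min (interp dt dx dv (sample dx dv phi_in) i) (mu_in i).

Definition is_scheme_solution {R : realType} (Nt : nat) (dt dx dv : R)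
    (phi_in : R -> R -> R) (mu_in : int -> R)
    (mu : nat -> int -> R) (phi : nat -> int -> int -> R) : Prop :=
  [/\ forall i, mu 0%N i = mu_in i,
      forall i j, phi 0%N i j = sample dx dv phi_in i j,
      forall n, (n < Nt)%N -> forall i,
        is_min (interp dt dx dv (phi n) i) (mu n.+1 i)
    & forall n, (n < Nt)%N -> forall i j,
        phi n.+1 i j = Num.min (interp dt dx dv (phi n) i j + dt)
                               (grid dv j ^+ 2 / 2 + mu n.+1 i)].

(* A piecewise linear curve with [njump] velocity changes. Only
   [jump_time 0 .. jump_time njump.+1] and [velocity 0 .. velocity njump] are
   used, where [jump_time njump.+1] is the final time. *)
Record kpath (R : realType) := KPath {
  start : R;
  njump : nat;
  jump_time : nat -> R;
  velocity : nat -> R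
}.

Definition is_kpath {R : realType} (t x v : R) (g : kpath R) : Prop :=
  let N := njump g in
  let s := jump_time g in
  let w := velocity g in
  [/\ s 0%N = 0,
      forall k, (k < N)%N -> s k < s k.+1,
      s N <= t /\ s N.+1 = t,
      forall k, (1 <= k <= N)%N -> w k != w k.-1
    & w N = v /\ start g + \sum_(0 <= k < N.+1) (s k.+1 - s k) * w k = x].

Definition action {R : realType} (g : kpath R) : R :=
  let N := njump g in
  let s := jump_time g in
  let w := velocity g in
  2^-1 * (\sum_(1 <= k < N.+1) `|w k| ^+ 2)
  + \sum_(0 <= k < N.+1) (s k.+1 - s k) * (w k != 0)%:R.

(* Viscosity solution of the limit problem, given by the kinetic Hopf-Lax
   formula. For [0 < t] and [phi_in] bounded below the set is nonempty and
   bounded below, so [inf] is the genuine infimum. *)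
Definition hopf_lax {R : realType} (phi_in : R -> R -> R) (t x v : R) : R :=
  inf [set phi_in (start g) (velocity g 0%N) + action g
      | g in [set g | is_kpath t x v g]].

(* Main.v *)
Require Import Defs.
From mathcomp Require Import all_boot all_order all_algebra.
From mathcomp Require Import all_classical all_reals all_analysis.
From mathcomp Require Import ring lra.

(** The scheme and the Hopf-Lax function W solve almost the same control problem: a
    particle flies at constant velocity, pays 1 per unit of time unless it is at
    rest, and pays v^2/2 to jump to the velocity v. They differ in three ways. Each
    step of the scheme displaces the foot of a characteristic by up to dx, over T/dt
    steps; its velocities and jump times are rounded, by dv and dt; and the step that
    precedes a jump is not charged for its flight. Everything is Lipschitz in x with
    a constant K, so the first two cost O(dx/dt + dv) in total, plus O(dt (1 + |w|))
    for each jump to w. The difficulty is that nothing bounds the number of jumps.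

    It is resolved by the threshold K|w| = 1. Flying at a velocity w with K|w| <= 1
    never beats resting: over a duration h it changes the value by at most
    K|w|h <= h, which is the price of the flight. Jumps to slow velocities can
    therefore be ignored. A jump to a fast velocity costs w^2/2 with
    K|w| <= K^2 w^2, so an error of K|w| dt, or of dt, is at most c w^2/2 with
    c = 2 K^2 dt, that is, a small fraction of the cost of that very jump. All
    comparisons are thus made up to the factor 1 + c on costs, in terms of
    (1 + c)(cost + M) - M, where cost + M is nonnegative, and the number of jumps
    disappears.

    Upper bound on W ([hopf_lax_le_scheme]): by induction on the time step, the
    scheme dominates a [barrier] built from W. The barrier adds dt to W for a fast
    velocity, as a credit that pays the flight missing before the next jump; for a
    slow velocity it also allows the value at rest plus the price of the jump. That
    the latter is still enough when the particle jumps out is the place where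
    dt <= dv^2/2 is used.

    Upper bound on the scheme ([scheme_le_hopf_lax]): along any kinetic path, by
    induction on its jumps, the value mu at the end of the time step containing the
    jump is at most the cost paid just before the jump, up to the errors above ([mu_cone_path]).

    [scheme_error] joins the two. The constants M and L are chosen from the initial
    datum alone, before the mesh; if it has none, there is nothing to prove. *)

Import Order.TTheory GRing.Theory Num.Theory.

Local Open Scope ring_scope.

Lemma mulr_bool_le {R : realType} {t : R} (b : bool) : 0 <= t -> t * b%:R <= t.
Proof. by move=> t0; rewrite ler_piMr// lern1 leq_b1. Qed.

(** * Linear interpolation *)

Section Interpolation.
Context {R : realType} (dt dx dv : R).
Implicit Types (u : int -> int -> R) (f : R -> R) (K : R).

(** Both interpolation nodes lie within dx of the foot of the characteristic, so
    for a Lipschitz function interpolating costs at most K dx. *)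
Lemma interp_ub u f K i j : 0 < dx -> 0 <= K ->
  (forall x y, f x <= f y + K * `|x - y|) ->
  (forall k, u k j <= f (grid dx k)) ->
  interp dt dx dv u i j <= f (grid dx i - dt * grid dv j) + K * dx.
Proof.
move=> dx0 K0 lipf uf; rewrite /interp.
set q := grid dv j * dt / dx; set b := Num.floor q; set a := q - b%:~R.
have a0 : 0 <= a by rewrite subr_ge0 floor_le.
have a1 : a < 1 by rewrite ltrBlDl -intrD1 floorD1_gt.
set z := grid dx i - _.
have qdx : dt * grid dv j = q * dx by rewrite /q divfK ?gt_eqF// mulrC.
have e0 : grid dx (i - b) - z = a * dx.
  by rewrite /z /grid qdx rmorphB /= /a; ring.
have e1 : grid dx (i - b - 1) - z = (a - 1) * dx.
  by rewrite /z /grid qdx !rmorphB /= /a; ring.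
have h0 : u (i - b) j <= f z + K * dx.
  apply: (le_trans (uf _)); apply: (le_trans (lipf _ z)).
  by rewrite lerD2l e0 ler_wpM2l// ger0_norm; nra.
have h1 : u (i - b - 1) j <= f z + K * dx.
  apply: (le_trans (uf _)); apply: (le_trans (lipf _ z)).
  by rewrite lerD2l e1 ler_wpM2l// ler0_norm; nra.
nra.
Qed.

(** Upper bounds of this conical shape are stable under a step of the scheme: the
    apex is transported by the flow. *)
Lemma interp_cone u K (B y : R) i j : 0 < dx -> 0 <= K ->
  (forall k, u k j <= B + K * `|grid dx k - y|) ->
  interp dt dx dv u i j <= B + K * dx + K * `|grid dx i - (y + dt * grid dv j)|.
Proof.
move=> dx0 K0 uB; rewrite addrAC (addrC y) opprD addrA.
apply: (@interp_ub u (fun x => B + K * `|x - y|)) => // x z.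
rewrite -addrA lerD2l -mulrDr ler_wpM2l//.
by rewrite (_ : x - y = (z - y) + (x - z)) ?ler_normD//; ring.
Qed.

Lemma interp_affine u (a b : R) i j :
  interp dt dx dv (fun k l => a * u k l + b) i j = a * interp dt dx dv u i j + b.
Proof. by rewrite /interp; ring. Qed.

Lemma interp_lb u f K i j : 0 < dx -> 0 <= K ->
  (forall x y, f x <= f y + K * `|x - y|) ->
  (forall k, f (grid dx k) <= u k j) ->
  f (grid dx i - dt * grid dv j) <= interp dt dx dv u i j + K * dx.
Proof.
move=> dx0 K0 lipf uf.
have lipNf x y : - f x <= - f y + K * `|x - y|.
  by have := lipf y x; rewrite distrC; lra.
have := @interp_ub (fun k l => -1 * u k l + 0) (fun x => - f x) K i j dx0 K0 lipNf.
rewrite interp_affine => H; suff: -1 * interp dt dx dv u i j + 0 <=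
  - f (grid dx i - dt * grid dv j) + K * dx by lra.
by apply: H => k; rewrite addr0 mulN1r lerN2.
Qed.

End Interpolation.

(** * Kinetic paths *)

Section KineticPaths.
Context {R : realType}.
Implicit Types (t x v h a : R) (g : kpath R) (phi_in : R -> R -> R).

Definition path_cost phi_in g := phi_in (start g) (velocity g 0%N) + action g.

Lemma kpath_step_ge0 {t x v g} k : is_kpath t x v g -> (k <= njump g)%N ->
  0 <= jump_time g k.+1 - jump_time g k.
Proof.
move=> [_ sS [sN sN1] _ _]; rewrite leq_eqVlt => /orP[/eqP ->|/sS].
  by rewrite sN1 subr_ge0.
by rewrite subr_ge0 => /ltW.
Qed.

Lemma kpath_time_le {t x v g} k : is_kpath t x v g -> (k <= njump g)%N ->
  jump_time g k <= t.
Proof.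
move=> [_ sS [sN _] _ _] kN; apply: le_trans sN.
have mono p : (k + p <= njump g)%N -> jump_time g k <= jump_time g (k + p).
  elim: p => [|p IH]; first by rewrite addn0.
  by rewrite addnS => pN; apply: le_trans (IH (ltnW pN)) (ltW (sS _ pN)).
by have := mono (njump g - k)%N; rewrite subnKC//; apply.
Qed.

Lemma action_ge0 {t x v g} : is_kpath t x v g -> 0 <= action g.
Proof.
move=> gP; rewrite /action addr_ge0//.
  by rewrite mulr_ge0 ?invr_ge0// sumr_ge0// => k _; rewrite sqr_ge0.
rewrite big_nat sumr_ge0// => k /andP[_ kN].
by rewrite mulr_ge0//; exact: (kpath_step_ge0 _ gP).
Qed.

Lemma kpath_const phi_in t x v : 0 <= t -> exists2 g, is_kpath t x v g &
  path_cost phi_in g = phi_in (x - t * v) v + t * (v != 0)%:R.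
Proof.
move=> t0; exists (@KPath R (x - t * v) 0 (fun k => if k is 0%N then 0 else t)
  (fun=> v)).
  split => //=; first by case=> [|k]; rewrite ?ltnn.
  by split=> //; rewrite big_nat1 subr0 subrK.
by rewrite /path_cost /action /= big_nat1 big_geq// mulr0 add0r subr0.
Qed.

Lemma kpath_shift a phi_in t x v g : is_kpath t x v g -> exists2 g',
  is_kpath t (x + a) v g' & path_cost phi_in g' =
    phi_in (start g + a) (velocity g 0%N) + action g.
Proof.
case: g => y N s w [s0 sS sN ww [wN <-]].
exists (@KPath R (y + a) N s w) => //; split => //=; split => //=.
by rewrite addrAC.
Qed.

Lemma kpath_extend h phi_in t x v g : 0 <= h -> is_kpath t x v g -> exists2 g',
  is_kpath (t + h) (x + h * v) v g' &
  path_cost phi_in g' = path_cost phi_in g + h * (v != 0)%:R.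
Proof.
case: g => y N s w h0 [/= s0 sS [sN sN1] ww [wN xE]].
pose s' (k : nat) := if k == N.+1 then t + h else s k.
have s'E k : (k <= N)%N -> s' k = s k by rewrite /s'; case: eqP => // ->; rewrite ltnn.
have s'N1 : s' N.+1 = t + h by rewrite /s' eqxx.
clearbody s'.
have sum_ext (F : nat -> R) : \sum_(0 <= k < N.+1) (s' k.+1 - s' k) * F k =
    \sum_(0 <= k < N.+1) (s k.+1 - s k) * F k + h * F N.
  rewrite !big_nat_recr//= s'N1 (s'E N)// sN1.
  rewrite (eq_big_nat _ _ (F2 := fun k => (s k.+1 - s k) * F k)); last first.
    by move=> k /andP[_ kN]; rewrite !s'E// ltnW.
  by ring.
exists (@KPath R y N s' w).
  split => //=; first by rewrite s'E.
  - by move=> k kN; rewrite !s'E// ?sS// ltnW.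
  - by rewrite s'E//; split => //; rewrite (le_trans sN)// lerDl.
  - by split => //; rewrite sum_ext wN -xE addrA.
by rewrite /path_cost /action /= sum_ext wN; ring.
Qed.

(** Jump times being strictly increasing, a jump at the final time cannot always be
    appended: when the path has already jumped at time t, that last jump is
    redirected to v, or deleted if the velocity before it was v. *)
Lemma kpath_jump phi_in t x u v g : 0 < t -> is_kpath t x u g -> exists2 g',
  is_kpath t x v g' & path_cost phi_in g' <= path_cost phi_in g + v ^+ 2 / 2.
Proof.
have [->|uv] := eqVneq u v.
  by move=> _ gP; exists g => //; rewrite lerDl divr_ge0// sqr_ge0.
case: g => y N s w t0 [/= s0 sS [sN sN1] ww [wN xE]].
have [sNt|sNt] := ltP (s N) t.
  pose s' (k : nat) := if (k <= N.+1)%N then s k else t.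
  pose w' (k : nat) := if (k <= N)%N then w k else v.
  have s'E k : (k <= N.+1)%N -> s' k = s k by rewrite /s' => ->.
  have w'E k : (k <= N)%N -> w' k = w k by rewrite /w' => ->.
  have w'N : w' N.+1 = v by rewrite /w' ltnn.
  have s'N : s' N.+2 = t by rewrite /s' ltnn.
  clearbody s' w'.
  have sum_ext (f : R -> R) : \sum_(0 <= k < N.+2) (s' k.+1 - s' k) * f (w' k) =
      \sum_(0 <= k < N.+1) (s k.+1 - s k) * f (w k).
    rewrite big_nat_recr//= s'N s'E// sN1 subrr mul0r addr0.
    by apply: eq_big_nat => k /andP[_ kN]; rewrite !s'E ?w'E// ltnW.
  exists (@KPath R y N.+1 s' w').
    split => //=; first by rewrite s'E.
    - move=> k; rewrite ltnS leq_eqVlt => /orP[/eqP ->|kN].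
        by rewrite !s'E// sN1.
      by rewrite !s'E// ?sS// ltnW// ltnW.
    - by rewrite s'E// sN1.
    - move=> k /andP[k0]; rewrite leq_eqVlt => /orP[/eqP ->|kN].
        by rewrite w'N w'E//= wN eq_sym.
      have kN' : (k.-1 <= N)%N := leq_trans (leq_pred k) kN.
      by rewrite (w'E _ kN) (w'E _ kN') ww// k0.
    - by split => //; rewrite (sum_ext id).
  rewrite /path_cost /action /= (sum_ext (fun w => (w != 0)%:R)).
  rewrite big_nat_recr//= w'N w'E//.
  rewrite (eq_big_nat _ _ (F2 := fun k => `|w k| ^+ 2)).
    by rewrite -(real_normK (num_real v)); lra.
  by move=> k /andP[_ kN]; rewrite w'E.
have sNE : s N = t by apply/eqP; rewrite eq_le sN.
case: N => [|N] in sS sN sN1 ww wN xE sNt sNE *; first by rewrite -sNE s0 ltxx in t0.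
have [wv|wv] := eqVneq (w N) v.
  exists (@KPath R y N s w).
    split => //=.
    - by move=> k kN; apply: sS; rewrite ltnW.
    - by split => //; rewrite -sNE ltW// sS.
    - by move=> k /andP[k0 kN]; rewrite ww// k0 ltnW.
    - by split => //; rewrite -xE [in RHS]big_nat_recr//= sN1 sNE subrr mul0r addr0.
  rewrite /path_cost /action /= (big_nat_recr N.+1 1)//= (big_nat_recr N.+1 0)//=.
  rewrite sN1 sNE subrr mul0r addr0.
  by have := sqr_ge0 `|w N.+1|; have := sqr_ge0 v; lra.
pose w' (k : nat) := if (k <= N)%N then w k else v.
have w'E k : (k <= N)%N -> w' k = w k by rewrite /w' => ->.
have w'N : w' N.+1 = v by rewrite /w' ltnn.
clearbody w'.
have sum_ext (f : R -> R) : \sum_(0 <= k < N.+2) (s k.+1 - s k) * f (w' k) =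
    \sum_(0 <= k < N.+2) (s k.+1 - s k) * f (w k).
  rewrite !(big_nat_recr N.+1)//= sN1 sNE subrr !mul0r; congr (_ + _).
  by apply: eq_big_nat => k /andP[_ kN]; rewrite w'E.
exists (@KPath R y N.+1 s w').
  split => //=.
    move=> k /andP[k0]; rewrite leq_eqVlt => /orP[/eqP ->|kN].
      by rewrite w'N w'E//= eq_sym.
    have kN' : (k.-1 <= N)%N := leq_trans (leq_pred k) kN.
    by rewrite (w'E _ kN) (w'E _ kN') ww// k0/= ltnW.
  by split => //; rewrite (sum_ext id).
rewrite /path_cost /action /= (sum_ext (fun w => (w != 0)%:R)).
rewrite [in leLHS](@big_nat_recr _ _ _ N.+1 1)//=.
rewrite [in leRHS](@big_nat_recr _ _ _ N.+1 1)//= w'N.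
rewrite (eq_big_nat _ _ (F2 := fun k => `|w k| ^+ 2)).
  rewrite (w'E 0%N)//.
  by have := sqr_ge0 `|w N.+1|; rewrite -(real_normK (num_real v)); lra.
by move=> k /andP[_ kN]; rewrite w'E.
Qed.

Definition path_pos g k :=
  start g + \sum_(0 <= l < k) (jump_time g l.+1 - jump_time g l) * velocity g l.

(** The cost accumulated up to the k-th jump time, excluding the price of the k-th
    jump itself. *)
Definition path_cost_before phi_in g k :=
  phi_in (start g) (velocity g 0%N)
  + (2^-1 * (\sum_(1 <= l < k) `|velocity g l| ^+ 2)
     + \sum_(0 <= l < k) (jump_time g l.+1 - jump_time g l) * (velocity g l != 0)%:R).

Lemma path_posS g k : path_pos g k.+1 =
  path_pos g k + (jump_time g k.+1 - jump_time g k) * velocity g k.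
Proof. by rewrite /path_pos big_nat_recr//= addrA. Qed.

Lemma path_cost_beforeS phi_in g k : (0 < k)%N ->
  path_cost_before phi_in g k.+1 = path_cost_before phi_in g k
    + velocity g k ^+ 2 / 2
    + (jump_time g k.+1 - jump_time g k) * (velocity g k != 0)%:R.
Proof.
move=> k0; rewrite /path_cost_before (big_nat_recr k 1)//= (big_nat_recr k 0)//=.
by rewrite -[velocity g k ^+ 2]real_normK ?num_real//; ring.
Qed.

End KineticPaths.

(** * The kinetic Hopf-Lax function *)

Section HopfLax.
Context {R : realType} (phi_in : R -> R -> R) (M K : R).
Hypothesis phi_bound : forall x v, `|phi_in x v - v ^+ 2 / 2| <= M.
Hypothesis phi_lipx :
  forall v x y, phi_in x v <= phi_in y v + K * `|x - y|.
Implicit Types (t x y u v h b e : R) (g : kpath R).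

Let phi_ge x v : v ^+ 2 / 2 - M <= phi_in x v.
Proof. by have := phi_bound x v; rewrite ler_norml => /andP[]; lra. Qed.

Let cost_lb {t x v g} : is_kpath t x v g -> - M <= path_cost phi_in g.
Proof.
move=> /action_ge0; rewrite /path_cost.
by have := phi_ge (start g) (velocity g 0%N); have := sqr_ge0 (velocity g 0%N); lra.
Qed.

Lemma hopf_lax_le t x v g :
  is_kpath t x v g -> hopf_lax phi_in t x v <= path_cost phi_in g.
Proof.
move=> gP; apply: ge_inf; last by exists g.
by exists (- M) => _ [g' g'P <-]; exact: cost_lb g'P.
Qed.

Lemma hopf_lax_ge t x v b : 0 <= t ->
  (forall g, is_kpath t x v g -> b <= path_cost phi_in g) ->
  b <= hopf_lax phi_in t x v.
Proof.
move=> t0 bP; apply: lb_le_inf.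
  by have [g gP _] := kpath_const phi_in _ x v t0; exists (path_cost phi_in g), g.
by move=> _ [g gP <-]; exact: bP gP.
Qed.

Lemma hopf_lax_transfer t x v t' x' v' e : 0 <= t ->
  (forall g, is_kpath t x v g -> exists2 g', is_kpath t' x' v' g' &
     path_cost phi_in g' <= path_cost phi_in g + e) ->
  hopf_lax phi_in t' x' v' <= hopf_lax phi_in t x v + e.
Proof.
move=> t0 gg'; rewrite -lerBlDr; apply: hopf_lax_ge => // g /gg'[g' g'P le_g'g].
by rewrite lerBlDr; exact: le_trans (hopf_lax_le _ _ _ _ g'P) le_g'g.
Qed.

Lemma hopf_lax_free t x v : 0 <= t ->
  hopf_lax phi_in t x v <= phi_in (x - t * v) v + t * (v != 0)%:R.
Proof.
by move=> t0; have [g gP <-] := kpath_const phi_in _ x v t0; exact: hopf_lax_le.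
Qed.

Lemma hopf_lax_lip t x y v : 0 <= t ->
  hopf_lax phi_in t x v <= hopf_lax phi_in t y v + K * `|x - y|.
Proof.
move=> t0; apply: hopf_lax_transfer => // g.
move=> /(kpath_shift (x - y) phi_in)[g']; rewrite subrKC => g'P g'E; exists g' => //.
have := phi_lipx (velocity g 0%N) (start g + (x - y)) (start g).
by rewrite [_ + (x - y) - _]addrAC subrr add0r g'E /path_cost; lra.
Qed.

Lemma hopf_lax_flight h t x v : 0 <= t -> 0 <= h ->
  hopf_lax phi_in (t + h) x v <= hopf_lax phi_in t (x - h * v) v + h * (v != 0)%:R.
Proof.
move=> t0 h0; apply: hopf_lax_transfer => // g.
move=> /(kpath_extend h phi_in _ _ _ _ h0)[g']; rewrite subrK => g'P g'E.
by exists g' => //; rewrite g'E.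
Qed.

Lemma hopf_lax_jump t x u v : 0 < t ->
  hopf_lax phi_in t x v <= hopf_lax phi_in t x u + v ^+ 2 / 2.
Proof.
by move=> t0; apply: hopf_lax_transfer => [|g]; [exact: ltW|exact: kpath_jump].
Qed.

Lemma hopf_lax_ub t x v : 0 <= t -> hopf_lax phi_in t x v <= v ^+ 2 / 2 + M + t.
Proof.
move=> t0; apply: (le_trans (hopf_lax_free _ _ _ t0)).
have := phi_bound (x - t * v) v; rewrite ler_norml => /andP[_].
by have := mulr_bool_le (v != 0) t0; lra.
Qed.

End HopfLax.

(** * The barrier under the scheme *)

Section Barrier.
Context {R : realType} (phi_in : R -> R -> R) (M K dt : R).
Hypothesis phi_bound : forall x v, `|phi_in x v - v ^+ 2 / 2| <= M.
Hypothesis phi_lipx :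
  forall v x y, phi_in x v <= phi_in y v + K * `|x - y|.
Hypotheses (K0 : 0 < K) (dt0 : 0 < dt) (dt_small : 2 * K ^+ 2 * dt <= 1).
Implicit Types (t x y u v : R).

Local Notation W := (hopf_lax phi_in).

(** The term dt is the credit for the flight that the scheme does not charge in the
    step before a jump. The fraction 2 K^2 dt of the jump cost v^2/2 pays for this
    credit only if v is fast; for a slow v, the second argument of the minimum stands
    for a particle that rests and keeps v^2/2 in reserve. *)
Definition barrier t x v :=
  if K * `|v| < 1 then Num.min (W t x v + dt) (W t x 0 + v ^+ 2 / 2)
  else W t x v + dt.

Lemma barrier_le t x v : barrier t x v <= W t x v + dt.
Proof. by rewrite /barrier; case: ifP => // _; rewrite ge_min lexx. Qed.

Lemma barrier_lip t x y v : 0 <= t ->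
  barrier t x v <= barrier t y v + K * `|x - y|.
Proof.
move=> t0; have h := hopf_lax_lip _ _ _ phi_bound phi_lipx t x y.
rewrite /barrier; case: ifP => _; last by have := h v t0; lra.
rewrite -lerBlDr le_min; apply/andP; split; rewrite lerBlDr ge_min.
  by apply/orP; left; have := h v t0; lra.
by apply/orP; right; have := h 0 t0; lra.
Qed.

Let flight t x v := hopf_lax_flight _ _ phi_bound dt t x v.
Let jump t x u v := hopf_lax_jump _ _ phi_bound t x u v.

Let rest t x : 0 <= t -> W (t + dt) x 0 <= W t x 0.
Proof.
by move=> t0; have := flight t x 0 t0 (ltW dt0); rewrite mulr0 subr0 eqxx mulr0 addr0.
Qed.

Let wait t x v : 0 <= t -> W (t + dt) x v <= W t (x - dt * v) v + dt.
Proof.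
move=> t0; apply: (le_trans (flight t x v t0 (ltW dt0))).
by rewrite lerD2l mulr_bool_le// ltW.
Qed.

Let slip t x v : 0 <= t -> W (t + dt) x 0 <= W t (x - dt * v) 0 + K * `|v| * dt.
Proof.
move=> t0; apply: (le_trans (rest t x t0)).
have := hopf_lax_lip _ _ _ phi_bound phi_lipx t x (x - dt * v) 0 t0.
by rewrite subKr normrM (gtr0_norm dt0); lra.
Qed.

(** For the resting alternative, moving by dt v changes W by K|v|dt, which is at
    most the cost dt of the flight because v is slow. *)
Lemma barrier_flight t x v : 0 <= t ->
  barrier (t + dt) x v <= barrier t (x - dt * v) v + dt.
Proof.
move=> t0; have hw := wait t x v t0; rewrite /barrier.
case: ifP => [Kv|_]; last by lra.
rewrite -lerBlDr le_min; apply/andP; split; rewrite lerBlDr ge_min.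
  by apply/orP; left; lra.
have Kvdt : K * `|v| * dt <= dt by rewrite ger_pMl// ltW.
by apply/orP; right; have := slip t x v t0; lra.
Qed.

(** The step of flight before a jump, which the scheme does not charge. For a fast
    velocity the credit dt pays for it. For a slow one the reserve v^2/2 pays for
    the displacement K|v|dt: from 2 dt <= v^2 and 2 K^2 dt <= 1 it follows that
    2 K dt <= |v|. *)
Lemma barrier_jump_out t x v : 0 <= t -> v = 0 \/ 2 * dt <= v ^+ 2 ->
  W (t + dt) x 0 <= barrier t (x - dt * v) v.
Proof.
move=> t0 vP.
have td0 : 0 < t + dt by rewrite ltr_wpDl.
have h1 : W (t + dt) x 0 <= W t (x - dt * v) v + dt.
  have := jump (t + dt) x v 0 td0; rewrite expr0n/= mul0r addr0 => /le_trans; apply.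
  exact: wait.
rewrite /barrier; case: ifP => [_|_ //]; rewrite le_min h1/=.
apply: (le_trans (slip t x v t0)); rewrite lerD2l.
case: vP => [->|vdt]; first by rewrite normr0 expr0n/= mulr0 !mul0r.
have nv : v ^+ 2 = `|v| ^+ 2 by rewrite real_normK ?num_real.
rewrite nv in vdt *.
have nv0 : 0 <= `|v| by [].
have Kdt : 2 * (K * dt) <= `|v|.
  have Kdt0 : 0 <= 2 * (K * dt) by rewrite !mulr_ge0// ltW.
  rewrite -(@ler_pXn2r _ 2)//.
  have : 2 * K ^+ 2 * dt * dt <= dt by rewrite ger_pMl.
  by lra.
by nra.
Qed.

(** A jump to a fast velocity finances the credit dt by the fraction 2 K^2 dt of its
    own cost, because K|v| >= 1. *)
Lemma barrier_jump_in t x v : 0 < t ->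
  barrier t x v <= W t x 0 + (1 + 2 * K ^+ 2 * dt) * (v ^+ 2 / 2).
Proof.
move=> t0; rewrite /barrier; have v0 := sqr_ge0 v.
have c0 : 0 <= 2 * K ^+ 2 * dt by rewrite !mulr_ge0// ?sqr_ge0// ltW.
case: ifPn => [_|]; first by rewrite ge_min; apply/orP; right; nra.
rewrite -leNgt => Kv; have := jump t x 0 v t0.
have : 1 <= K ^+ 2 * v ^+ 2.
  have -> : K ^+ 2 * v ^+ 2 = (K * `|v|) ^+ 2.
    by rewrite exprMn real_normK ?num_real.
  by rewrite exprn_ege1.
by move=> /(ler_peMl (ltW dt0)); lra.
Qed.

Lemma hopf_lax_le_barrier t x v : 0 < t -> W t x v <= barrier t x v.
Proof.
move=> t0; rewrite /barrier; have := jump t x 0 v t0.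
by case: ifP => [_ h|_ _]; rewrite ?le_min ?h lerDl ltW.
Qed.

End Barrier.

(** * Rounding to the grid *)

Section Grid.
Context {R : realType}.
Implicit Types (h w q : R).

Lemma grid0 h : grid h 0 = 0.
Proof. by rewrite /grid mul0r. Qed.

Lemma grid_sqr_ge h j : 0 < h -> grid h j = 0 \/ h ^+ 2 <= grid h j ^+ 2.
Proof.
move=> h0; have [->|j0] := eqVneq j 0; [by left; rewrite grid0|right].
rewrite /grid exprMn ler_peMl ?sqr_ge0// -(real_normK (num_real _)) exprn_ege1//.
by rewrite -intr_norm ler1z -gtz0_ge1 normr_gt0.
Qed.

(** Rounding is towards 0, so that no jump becomes more expensive and rest stays
    rest. *)
Lemma grid_round h w : 0 < h ->
  exists j, `|grid h j| <= `|w| /\ `|grid h j - w| <= h.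
Proof.
move=> h0.
wlog w0 : w / 0 <= w.
  move=> hw; have [/hw//|/ltW] := leP 0 w.
  rewrite -oppr_ge0 => /hw[j []]; rewrite normrN => jw jh.
  exists (- j); have -> : grid h (- j) = - grid h j.
    by rewrite /grid rmorphN mulNr.
  by rewrite normrN -opprD normrN; move: jh; rewrite opprK.
exists (Num.floor (w / h)); rewrite /grid; set f := (Num.floor _)%:~R.
have f0 : 0 <= f by rewrite ler0z floor_ge0 divr_ge0// ltW.
have fw : f * h <= w by rewrite -ler_pdivlMr// floor_le.
have wf : w < f * h + h.
  by rewrite -[X in _ + X]mul1r -mulrDl -ltr_pdivrMr// -intrD1 floorD1_gt.
rewrite (ger0_norm (mulr_ge0 f0 (ltW h0))) (ger0_norm w0); split => //.
by rewrite ler_norml; apply/andP; split; lra.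
Qed.

Lemma time_cell h q : 0 < h -> 0 < q ->
  exists m : nat, m%:R * h < q /\ q <= m.+1%:R * h.
Proof.
move=> h0 q0.
have ex : exists n : nat, q <= n%:R * h.
  exists (Num.bound (q / h)).
  by rewrite -ler_pdivrMr// ltW// archi_boundP// divr_ge0// ltW.
case: (ex_minnP ex) => -[|m] qm min_m; first by rewrite mul0r leNgt q0 in qm.
exists m; split => //; rewrite ltNge; apply/negP => /min_m.
by rewrite ltnn.
Qed.

End Grid.

(** * The scheme *)

Section Scheme.
Context {R : realType} (phi_in : R -> R -> R) (M K : R).
Hypothesis phi_bound : forall x v, `|phi_in x v - v ^+ 2 / 2| <= M.
Hypothesis phi_lipx :
  forall v x y, phi_in x v <= phi_in y v + K * `|x - y|.
Hypothesis K0 : 0 < K.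
Context (Nt : nat) (dt dx dv : R) (mu_in : int -> R)
  (mu : nat -> int -> R) (phi : nat -> int -> int -> R).
Hypotheses (dt0 : 0 < dt) (dx0 : 0 < dx) (dv0 : 0 < dv).
Hypothesis sol : is_scheme_solution Nt dt dx dv phi_in mu_in mu phi.
Implicit Types (i j : int) (n m p : nat).

Lemma scheme_init i j : phi 0%N i j = phi_in (grid dx i) (grid dv j).
Proof. by case: sol => _ ->. Qed.

Lemma scheme_next n i j : (n < Nt)%N ->
  phi n.+1 i j = Num.min (interp dt dx dv (phi n) i j + dt)
                         (grid dv j ^+ 2 / 2 + mu n.+1 i).
Proof. by case: sol => _ _ _ next /next ->. Qed.

Lemma mu_le_interp n i j : (n < Nt)%N -> mu n.+1 i <= interp dt dx dv (phi n) i j.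
Proof. by case: sol => _ _ h _ /h /(_ i)[_ le_mu]; exact: le_mu. Qed.

Lemma mu_attained n i : (n < Nt)%N ->
  exists j, mu n.+1 i = interp dt dx dv (phi n) i j.
Proof. by case: sol => _ _ h _ /h /(_ i)[[j <-] _]; exists j. Qed.

Lemma interp_rest (u : int -> int -> R) i : interp dt dx dv u i 0 = u i 0.
Proof. by rewrite /interp grid0 !mul0r floor0 subrr subr0 mul1r mul0r addr0 subr0. Qed.

Lemma phi_jump n i j : (n < Nt)%N -> phi n.+1 i j <= grid dv j ^+ 2 / 2 + mu n.+1 i.
Proof. by move=> nN; rewrite scheme_next// ge_min lexx orbT. Qed.

Lemma phi_rest n i : (n < Nt)%N -> phi n.+1 i 0 <= mu n.+1 i.
Proof. by move=> nN; have := phi_jump n i 0 nN; rewrite grid0 expr0n/= mul0r add0r. Qed.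

(** At rest the step is free in the scheme too: the velocity 0 competes in
    the minimum mu and jumping to 0 costs nothing. *)
Lemma phi_step n i j : (n < Nt)%N ->
  phi n.+1 i j <= interp dt dx dv (phi n) i j + dt * (grid dv j != 0)%:R.
Proof.
move=> nN; have [vj0|_] := eqVneq (grid dv j) 0.
  rewrite mulr0 addr0; apply: le_trans (mu_le_interp n i j nN).
  by have := phi_jump n i j nN; rewrite vj0 expr0n/= mul0r add0r.
by rewrite mulr1 scheme_next// ge_min lexx.
Qed.

Lemma mu_decr m n i : (0 < m <= n)%N -> (n <= Nt)%N -> mu n i <= mu m i.
Proof.
move=> /andP[m0 mn]; rewrite -(subnK mn); elim: (n - m)%N => // p IH.
rewrite addSn => pN; apply: le_trans (IH (ltnW pN)).
apply: (le_trans (mu_le_interp _ i 0 pN)); rewrite interp_rest.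
have [q qE] : exists q, (p + m)%N = q.+1.
  by exists (p + m).-1; rewrite prednK// addn_gt0 m0 orbT.
by rewrite qE in pN *; apply: phi_rest; exact: ltnW.
Qed.

Lemma phi_lb n i j : (n <= Nt)%N -> - M <= phi n i j.
Proof.
elim: n i j => [|n IH] i j nN.
  rewrite scheme_init; have := phi_bound (grid dx i) (grid dv j).
  by rewrite ler_norml => /andP[]; have := sqr_ge0 (grid dv j); lra.
have lb k l : - M <= interp dt dx dv (phi n) k l.
  have := @interp_lb R dt dx dv (phi n) (fun=> - M) 0 k l dx0 (lexx _).
  rewrite mul0r addr0; apply.
  - by move=> *; rewrite mul0r addr0.
  - by move=> k'; exact: IH (ltnW nN).
rewrite scheme_next// le_min; apply/andP; split.
  by rewrite -[- M]addr0 lerD ?lb// ltW.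
by have [l ->] := mu_attained n i nN; have := lb i l; have := sqr_ge0 (grid dv j); lra.
Qed.

Lemma phi_ub n i j : (0 < n <= Nt)%N -> phi n i j <= grid dv j ^+ 2 / 2 + M.
Proof.
case: n => // n nN; apply: (le_trans (phi_jump n i j nN)); rewrite lerD2l.
apply: (le_trans (mu_decr 1 n.+1 i isT nN)).
apply: (le_trans (mu_le_interp 0 i 0 (leq_ltn_trans (leq0n _) nN))).
rewrite interp_rest scheme_init grid0.
have := phi_bound (grid dx i) 0.
by rewrite expr0n/= mul0r subr0; apply: le_trans; exact: ler_norm.
Qed.

(** Flying for p steps from time n costs p dt, except at rest, and
    each step adds the interpolation error K dx. *)
Lemma phi_flight n p j (B y : R) : (n + p <= Nt)%N ->
  (forall i, phi n i j <= B + K * `|grid dx i - y|) ->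
  forall i, phi (n + p)%N i j <=
    B + p%:R * dt * (grid dv j != 0)%:R + p%:R * (K * dx)
    + K * `|grid dx i - (y + p%:R * dt * grid dv j)|.
Proof.
move=> + phin; elim: p => [|p IH] pN i; first by rewrite addn0 !mul0r !addr0.
rewrite addnS in pN *.
apply: (le_trans (phi_step _ i j pN)).
have := interp_cone dt dx dv _ K _ _ i j dx0 (ltW K0) (IH (ltnW pN)).
by rewrite -natr1 !mulrDl !mul1r -[y + _ + _]addrA; lra.
Qed.

(** The last of the p + 1 steps, which ends in the minimum over velocities, is not
    charged for its duration. *)
Lemma mu_flight n p j (B y : R) : (n + p < Nt)%N ->
  (forall i, phi n i j <= B + K * `|grid dx i - y|) ->
  forall i, mu (n + p).+1 i <=
    B + p%:R * dt * (grid dv j != 0)%:R + p.+1%:R * (K * dx)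
    + K * `|grid dx i - (y + p.+1%:R * dt * grid dv j)|.
Proof.
move=> pN phin i; apply: (le_trans (mu_le_interp _ i j pN)).
have := interp_cone dt dx dv _ K _ _ i j dx0 (ltW K0)
  (phi_flight _ _ _ _ _ (ltnW pN) phin).
by rewrite -natr1 !mulrDl !mul1r -[y + _ + _]addrA; lra.
Qed.


(** * The Hopf-Lax function is below the scheme *)

Local Notation t_ n := (n%:R * dt).
Local Notation c := (2 * K ^+ 2 * dt).

(** Each branch of the scheme is matched by one property of the barrier: flight by
    [barrier_flight], and a jump by leaving the old velocity for rest
    ([barrier_jump_out]) and then entering the new one ([barrier_jump_in]). *)
Lemma barrier_le_scheme n i j : dt <= dv ^+ 2 / 2 -> c <= 1 -> (n <= Nt)%N ->
  barrier phi_in K dt (t_ n) (grid dx i) (grid dv j)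
    <= (1 + c) * (phi n i j + M) - M + n%:R * (K * dx) + dt.
Proof.
move=> dt_dv dt_small.
have c0 : 0 <= c by rewrite !mulr_ge0// ?sqr_ge0// ltW.
elim: n i j => [|n IH] i j nN.
  rewrite mul0r; apply: (le_trans (barrier_le _ _ _ _ _ _)).
  have := hopf_lax_free _ _ phi_bound 0 (grid dx i) (grid dv j) (lexx _).
  have := phi_lb 0 i j nN; rewrite scheme_init !mul0r subr0 addr0.
  by nra.
have tn0 : 0 <= t_ n by rewrite mulr_ge0// ltW.
have tSn : t_ n.+1 = t_ n + dt by rewrite -natr1 mulrDl mul1r.
have tSn0 : 0 < t_ n.+1 by rewrite tSn ltr_wpDl.
(* The bound is affine in phi with a positive slope, so it commutes with
   interpolation; the barrier, being Lipschitz, loses K dx. *)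
have foot l : barrier phi_in K dt (t_ n) (grid dx i - dt * grid dv l) (grid dv l)
    <= (1 + c) * (interp dt dx dv (phi n) i l + M) - M
       + n.+1%:R * (K * dx) + dt.
  pose b := (1 + c) * M - M + n%:R * (K * dx) + dt.
  have := @interp_lb _ dt dx dv (fun k l => (1 + c) * phi n k l + b)
    (fun x => barrier phi_in K dt (t_ n) x (grid dv l)) K i l dx0 (ltW K0)
    (fun x y => barrier_lip _ _ _ _ phi_bound phi_lipx _ x y _ tn0).
  rewrite interp_affine -natr1 /b => h; apply: (le_trans (h _)).
    by move=> k; apply: le_trans (IH k l (ltnW nN)) _; lra.
  by lra.
rewrite scheme_next// minEle; case: ifP => _.
  rewrite tSn.
  apply: (le_trans (barrier_flight _ _ _ _ phi_bound phi_lipx dt0 _ _ _ tn0)).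
  by have := foot j; nra.
have [l ->] := mu_attained n i nN.
apply: (le_trans (barrier_jump_in _ _ _ _ phi_bound K0 dt0 _ _ _ tSn0)).
have vl : grid dv l = 0 \/ 2 * dt <= grid dv l ^+ 2.
  by case: (grid_sqr_ge dv l dv0) => ?; [left|right; lra].
have := barrier_jump_out _ _ _ _ phi_bound phi_lipx K0 dt0 dt_small _ (grid dx i)
  _ tn0 vl.
rewrite -tSn; have := foot l; lra.
Qed.

(** At the final time W is below the barrier, and the number of steps times dx is
    T dx/dt. *)
Lemma hopf_lax_le_scheme i j : dt <= dv ^+ 2 / 2 -> c <= 1 -> (0 < Nt)%N ->
  hopf_lax phi_in (t_ Nt) (grid dx i) (grid dv j)
    <= phi Nt i j + c * (grid dv j ^+ 2 / 2 + 2 * M) + t_ Nt * K * (dx / dt) + dt.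
Proof.
move=> dt_dv dt_small Nt0.
have tN0 : 0 < t_ Nt by rewrite mulr_gt0// ltr0n.
have c0 : 0 <= c by rewrite !mulr_ge0// ?sqr_ge0// ltW.
apply: (le_trans (hopf_lax_le_barrier _ _ K _ phi_bound dt0 _ _ _ tN0)).
apply: (le_trans (barrier_le_scheme _ _ _ dt_dv dt_small (leqnn _))).
have -> : t_ Nt * K * (dx / dt) = Nt%:R * (K * dx).
  by field; rewrite gt_eqF.
by have := phi_ub Nt i j; rewrite Nt0 leqnn => /(_ isT); nra.
Qed.

(** * The scheme is below the cost of every kinetic path *)

Hypothesis phi_lipv : forall x v w,
  `|v| <= `|w| -> phi_in x v <= phi_in x w + K * `|v - w|.

Local Notation err := (K * dx + dt * (K * dv)).

(** A particle that reaches the point y at the cost A bounds mu, by Lipschitz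
    continuity, on a cone with apex y. The inflated cost leaves c A to pay for
    the rounding of jump times, err is the error per step from
    interpolation and velocity rounding, and dt + K dv is paid once, for rounding the
    initial velocity. *)
Definition mu_cone m (A y : R) := forall i,
  mu m i <= (1 + c) * (A + M) - M + m%:R * err + (dt + K * dv)
    + K * `|grid dx i - y|.

Let c_ge0 : 0 <= c. Proof. by rewrite !mulr_ge0// ?sqr_ge0// ltW. Qed.

Let t_S n : t_ n.+1 = t_ n + dt. Proof. by rewrite -natr1 mulrDl mul1r. Qed.

Let t_ge0 n : 0 <= t_ n. Proof. by rewrite mulr_ge0// ltW. Qed.

(** Compares the rounded flight, of duration q at velocity u, with the true one, of
    duration h at velocity w. *)
Lemma drift_error (z y h w q u : R) : `|q - h| <= dt -> 0 <= q -> `|u - w| <= dv ->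
  K * `|z - (y + q * u)| <= K * `|z - (y + h * w)| + q * (K * dv) + dt * (K * `|w|).
Proof.
move=> qh q0 uw.
have -> : q * (K * dv) = K * (q * dv) by ring.
have -> : dt * (K * `|w|) = K * (dt * `|w|) by ring.
rewrite -!mulrDr ler_wpM2l ?(ltW K0)//.
have -> : z - (y + q * u) = (z - (y + h * w)) - q * (u - w) - (q - h) * w by ring.
apply: (le_trans (ler_normB _ _)); apply: lerD; last first.
  by rewrite normrM ler_wpM2r.
apply: (le_trans (ler_normB _ _)); rewrite lerD2l normrM (ger0_norm q0).
by rewrite ler_wpM2l.
Qed.

(** Stopping the first flight at the end of a time step instead of at time s costs
    K|w|dt <= dt + K^2 w^2 dt. The initial velocity has no jump cost, but
    phi_in + M >= w^2/2 plays its role. *)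
Lemma mu_cone_first m (y w s : R) : (m < Nt)%N -> t_ m < s -> s <= t_ m.+1 ->
  mu_cone m.+1 (phi_in y w + s * (w != 0)%:R) (y + s * w).
Proof.
move=> mN ms sm i.
have s0 : 0 < s := le_lt_trans (t_ge0 m) ms.
have [j [jw jdv]] := grid_round dv w dv0.
have init k : phi 0%N k j <= (phi_in y w + K * dv) + K * `|grid dx k - y|.
  rewrite scheme_init; apply: (le_trans (phi_lipx _ _ y)); rewrite lerD2r.
  by apply: (le_trans (phi_lipv _ _ _ jw)); rewrite lerD2l ler_wpM2l// ltW.
apply: (le_trans (mu_flight 0 m j _ _ mN init i)).
have near : `|t_ m.+1 - s| <= dt.
  by move: sm; rewrite ler_norml t_S => sm; apply/andP; split; lra.
have := drift_error (grid dx i) y s w (t_ m.+1) (grid dv j) near (t_ge0 _) jdv.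
have fly : t_ m * (grid dv j != 0)%:R <= s * (w != 0)%:R.
  have [w0|_] := eqVneq w 0.
    by move: jw; rewrite w0 normr0 normr_le0 => /eqP ->; rewrite eqxx !mulr0.
  by rewrite mulr1 (le_trans (mulr_bool_le _ (t_ge0 m)))// ltW.
have sw : 0 <= s * (w != 0)%:R by rewrite mulr_ge0// ltW.
have pw : 0 <= phi_in y w + M - w ^+ 2 / 2.
  by have := phi_bound y w; rewrite ler_norml => /andP[]; lra.
have amgm : dt * (K * `|w|) <= dt + c * (w ^+ 2 / 2).
  rewrite -[w ^+ 2]real_normK ?num_real//.
  have := mulr_ge0 (ltW dt0) (sqr_ge0 (K * `|w| - 1)).
  have := mulr_ge0 (ltW dt0) (sqr_ge0 (K * `|w|)); lra.
have := mulr_ge0 c_ge0 (addr_ge0 pw sw).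
by lra.
Qed.

(** One segment of the path, from a jump to w at time s to the next jump at time s'.
    If w is slow, mu just stays where it is: it is nonincreasing in time, and the
    displacement costs no more than the true flight. If w is fast and both jumps lie in
    the same time step, the displacement K|w|dt is charged to the jump cost. If w is
    fast and the jumps lie in different steps, the scheme jumps at the end of the
    first step and flies to the end of the second. *)
Lemma mu_cone_segment m m' (A y w s s' : R) :
  t_ m < s -> s <= t_ m.+1 -> s < s' -> t_ m' < s' -> s' <= t_ m'.+1 ->
  (m' < Nt)%N -> mu_cone m.+1 A y ->
  mu_cone m'.+1 (A + w ^+ 2 / 2 + (s' - s) * (w != 0)%:R) (y + (s' - s) * w).
Proof.
move=> ms sm ss' ms' sm' m'N mu_le i; set h := s' - s.
have h0 : 0 < h by rewrite subr_gt0.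
have mm' : (m <= m')%N.
  rewrite -ltnS -(ltr_nat R) -(ltr_pM2r dt0); apply: (lt_trans ms).
  exact: lt_le_trans sm'.
have mm'err : m.+1%:R * err <= m'.+1%:R * err.
  by rewrite ler_wpM2r ?ler_nat// addr_ge0// !mulr_ge0// ltW.
have w2 : 0 <= w ^+ 2 / 2 by rewrite divr_ge0// sqr_ge0.
have cw2 := mulr_ge0 c_ge0 w2.
have hw0 : 0 <= h * (w != 0)%:R by rewrite mulr_ge0// ltW.
have chw0 := mulr_ge0 c_ge0 hw0.
have stay : mu m'.+1 i <= (1 + c) * (A + M) - M + m'.+1%:R * err + (dt + K * dv)
    + K * `|grid dx i - (y + h * w)| + h * (K * `|w|).
  have mono : mu m'.+1 i <= mu m.+1 i by apply: mu_decr.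
  have := ler_wpM2l (ltW K0) (ler_normD (grid dx i - (y + h * w)) (h * w)).
  rewrite [_ - _ + _](_ : _ = grid dx i - y); last by ring.
  by rewrite normrM (gtr0_norm h0); have := mu_le i; lra.
have [Kw|Kw] := leP (K * `|w|) 1.
  have rest : h * (K * `|w|) <= h * (w != 0)%:R.
    have [->|_] := eqVneq w 0; first by rewrite normr0 !mulr0.
    by rewrite ler_pM2l.
  by lra.
have large : dt * (K * `|w|) <= c * (w ^+ 2 / 2).
  rewrite -[w ^+ 2]real_normK ?num_real//.
  have Kw1 : 0 <= K * `|w| - 1 by rewrite subr_ge0 ltW.
  by have := mulr_ge0 (ltW dt0) (mulr_ge0 (ltW (lt_trans ltr01 Kw)) Kw1); lra.
have [mm'E|mm'N] := eqVneq m m'.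
  have hdt : h * (K * `|w|) <= dt * (K * `|w|).
    rewrite ler_wpM2r//; first by rewrite mulr_ge0// ltW.
    by rewrite /h; move: ms sm'; rewrite mm'E t_S; lra.
  by lra.
have ltmm' : (m < m')%N by rewrite ltn_neqAle mm'N.
have [j [jw jdv]] := grid_round dv w dv0.
pose p := (m' - m.+1)%N.
have m'E : m' = (m.+1 + p)%N by rewrite subnKC.
have jump k : phi m.+1 k j <= grid dv j ^+ 2 / 2 + ((1 + c) * (A + M) - M
    + m.+1%:R * err + (dt + K * dv)) + K * `|grid dx k - y|.
  apply: (le_trans (phi_jump _ _ _ (leq_ltn_trans mm' m'N))).
  by have := mu_le k; lra.
have pN : (m.+1 + p < Nt)%N by rewrite -m'E.
have := mu_flight m.+1 p j _ _ pN jump i; rewrite -m'E.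
have pdt : t_ p.+1 = t_ m' - t_ m by rewrite m'E natrD -!natr1; ring.
have near : `|t_ p.+1 - h| <= dt.
  rewrite ler_norml pdt /h; move: ms sm ms' sm'; rewrite !t_S => *.
  by apply/andP; split; lra.
have := drift_error (grid dx i) y h w (t_ p.+1) (grid dv j) near (t_ge0 _) jdv.
have fly : t_ p * (grid dv j != 0)%:R <= h * (w != 0)%:R.
  have -> : w != 0 by apply: contraTneq Kw => ->; rewrite normr0 mulr0 ltr10.
  rewrite mulr1; apply: (le_trans (mulr_bool_le _ (t_ge0 _))).
  by move: pdt; rewrite t_S /h; move: sm ms'; rewrite t_S; lra.
have jw2 : grid dv j ^+ 2 / 2 <= w ^+ 2 / 2.
  rewrite ler_pM2r// -[w ^+ 2]real_normK ?num_real//.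
  by rewrite -[grid dv j ^+ 2]real_normK ?num_real// lerXn2r// ?nnegrE.
have -> : m'.+1%:R * err = m.+1%:R * err + p.+1%:R * (K * dx) + t_ p.+1 * (K * dv).
  by rewrite m'E -addnS natrD; ring.
by lra.
Qed.

Lemma mu_cone_path (x v : R) (g : kpath R) k :
  is_kpath (t_ Nt) x v g -> (0 < k <= njump g)%N ->
  exists m : nat, [/\ t_ m < jump_time g k, jump_time g k <= t_ m.+1,
    (m < Nt)%N & mu_cone m.+1 (path_cost_before phi_in g k) (path_pos g k)].
Proof.
move=> gP; have [s0 sS _ _ _] := gP.
have cell k' : (k' <= njump g)%N -> 0 < jump_time g k' -> exists m : nat,
    [/\ t_ m < jump_time g k', jump_time g k' <= t_ m.+1 & (m < Nt)%N].
  move=> k'N /(time_cell _ _ dt0)[m [ms sm]]; exists m; split => //.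
  have := lt_le_trans ms (kpath_time_le _ gP k'N).
  by rewrite ltr_pM2r// ltr_nat.
case: k => // k; elim: k => [|k IH] kN.
  have s1 : 0 < jump_time g 1 by rewrite -s0; exact: sS.
  have [m [ms sm mN]] := cell 1%N kN s1; exists m; split => //.
  have -> : path_pos g 1 = start g + jump_time g 1 * velocity g 0%N.
    by rewrite /path_pos big_nat1 s0 subr0.
  have -> : path_cost_before phi_in g 1 = phi_in (start g) (velocity g 0%N)
      + jump_time g 1 * (velocity g 0%N != 0)%:R.
    by rewrite /path_cost_before big_geq// big_nat1 s0 subr0 mulr0 add0r.
  exact: mu_cone_first.
have [m [ms sm mN mu_le]] := IH (ltnW kN).
have ss' := sS _ kN.
have s'0 : 0 < jump_time g k.+2.
  by apply: lt_trans ss'; exact: le_lt_trans ms.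
have [m' [ms' sm' m'N]] := cell k.+2 kN s'0; exists m'; split => //.
by rewrite path_posS path_cost_beforeS//; exact: mu_cone_segment mu_le.
Qed.

(** The last velocity lies on the grid but may be slow without being avoidable, so
    rounding the last jump time costs K|v|dt, which no jump cost pays for. *)
Lemma scheme_le_path_cost i j (g : kpath R) : (0 < Nt)%N ->
  is_kpath (t_ Nt) (grid dx i) (grid dv j) g ->
  phi Nt i j <= (1 + c) * (path_cost phi_in g + M) - M
    + Nt%:R * err + (dt + K * dv) + dt * (K * `|grid dv j|).
Proof.
move=> Nt0 gP; set v := grid dv j.
have [s0 sS [sN sN1] _ [wN xE]] := gP.
rewrite -/v in wN; have posE : path_pos g (njump g).+1 = grid dx i by [].
have costE : path_cost phi_in g = path_cost_before phi_in g (njump g).+1 by [].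
have Kv : 0 <= dt * (K * `|v|) by rewrite !mulr_ge0// ltW.
have Kdv : 0 <= K * dv by rewrite mulr_ge0// ltW.
have Kdx : 0 <= K * dx by rewrite mulr_ge0// ltW.
have Kdtdv : 0 <= dt * (K * dv) by rewrite mulr_ge0// ltW.
have costM : 0 <= path_cost phi_in g + M.
  rewrite /path_cost; have := action_ge0 gP.
  have := phi_bound (start g) (velocity g 0%N); rewrite ler_norml => /andP[+ _].
  by have := sqr_ge0 (velocity g 0%N); lra.
have ccost := mulr_ge0 c_ge0 costM.
have [N0|Npos] := posnP (njump g).
  have init k : phi 0%N k j <= phi_in (start g) v + K * `|grid dx k - start g|.
    by rewrite scheme_init; exact: phi_lipx.
  have := phi_flight 0 Nt j _ _ (leqnn _) init i; rewrite add0n -/v.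
  have w0 : velocity g 0%N = v by rewrite -wN N0.
  have s1 : jump_time g 1 = t_ Nt by rewrite -sN1 N0.
  have -> : grid dx i = start g + t_ Nt * v.
    by rewrite -posE N0 /path_pos big_nat1 s0 subr0 s1 w0.
  have cE : path_cost phi_in g = phi_in (start g) v + t_ Nt * (v != 0)%:R.
    by rewrite costE N0 /path_cost_before big_geq// big_nat1 s0 subr0 s1 w0 mulr0 add0r.
  have := dt0; have := mulr_ge0 (ler0n R Nt) Kdtdv.
  by rewrite subrr normr0 mulr0; move: ccost; rewrite cE; lra.
have [|m [ms sm mN mu_le]] := mu_cone_path _ _ g (njump g) gP.
  by rewrite Npos leqnn.
move: ccost; rewrite costE path_cost_beforeS// sN1 wN.
move: ms sm mu_le; set s := jump_time _ _; set y := path_pos _ _.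
set A := path_cost_before _ _ _; set h := t_ Nt - s => ms sm mu_le ccost.
pose p := (Nt - m.+1)%N.
have NE : Nt = (m.+1 + p)%N by rewrite subnKC.
have jump k : phi m.+1 k j <= v ^+ 2 / 2 + ((1 + c) * (A + M) - M
    + m.+1%:R * err + (dt + K * dv)) + K * `|grid dx k - y|.
  by apply: (le_trans (phi_jump _ _ _ mN)); have := mu_le k; rewrite -/v; lra.
have pN : (m.+1 + p <= Nt)%N by rewrite -NE.
have := phi_flight m.+1 p j _ _ pN jump i; rewrite -NE -/v.
have pdt : t_ p = t_ Nt - t_ m.+1 by rewrite NE natrD; ring.
have near : `|t_ p - h| <= dt.
  rewrite ler_norml pdt /h; move: ms sm; rewrite !t_S => *.
  by apply/andP; split; lra.
have vv : `|v - v| <= dv by rewrite subrr normr0 ltW.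
have := drift_error (grid dx i) y h v (t_ p) v near (t_ge0 _) vv.
have h0 : 0 <= h by rewrite subr_ge0.
have hv0 : 0 <= h * (v != 0)%:R by rewrite mulr_ge0.
have fly : t_ p * (v != 0)%:R <= h * (v != 0)%:R.
  by rewrite ler_wpM2r// pdt /h; lra.
have xyE : grid dx i = y + h * v.
  by rewrite -posE path_posS sN1 wN.
rewrite [_ - (y + h * v)](_ : _ = 0); last by rewrite xyE subrr.
have v2 : 0 <= v ^+ 2 / 2 by rewrite divr_ge0// sqr_ge0.
have cv2 := mulr_ge0 c_ge0 v2; have chv := mulr_ge0 c_ge0 hv0.
have -> : Nt%:R * err = m.+1%:R * err + p%:R * (K * dx) + t_ p * (K * dv).
  by rewrite NE natrD; ring.
by rewrite normr0 mulr0; lra.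
Qed.

Lemma scheme_le_hopf_lax i j : (0 < Nt)%N ->
  phi Nt i j <= hopf_lax phi_in (t_ Nt) (grid dx i) (grid dv j)
    + c * (grid dv j ^+ 2 / 2 + 2 * M + t_ Nt)
    + t_ Nt * K * (dx / dt + dv) + dt + K * dv + dt * (K * `|grid dv j|).
Proof.
move=> Nt0; set v := grid dv j; set W := hopf_lax _ _ _ _.
have c1 : 0 < 1 + c by rewrite ltr_pwDl.
have cW : c * W <= c * (v ^+ 2 / 2 + M + t_ Nt).
  by rewrite ler_wpM2l//; exact: hopf_lax_ub.
have eN : t_ Nt * K * (dx / dt + dv) = Nt%:R * err by field; rewrite gt_eqF.
pose b := M - Nt%:R * err - (dt + K * dv) - dt * (K * `|v|).
suff : (phi Nt i j + b) / (1 + c) - M <= W.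
  by rewrite lerBlDr ler_pdivrMr// /b eN; lra.
apply: hopf_lax_ge => [|g gP]; first exact: t_ge0.
rewrite lerBlDr ler_pdivrMr// /b; have := scheme_le_path_cost _ _ _ Nt0 gP.
by rewrite -/v; lra.
Qed.

(** The comparison from below needs c <= 1. If c > 1, the crude bounds on both
    functions suffice, since c multiplies them in the error. *)
Lemma scheme_error i j : dt <= dv ^+ 2 / 2 -> (0 < Nt)%N ->
  `|phi Nt i j - hopf_lax phi_in (t_ Nt) (grid dx i) (grid dv j)|
    <= c * (grid dv j ^+ 2 / 2 + 2 * M + t_ Nt)
      + t_ Nt * K * (dx / dt + dv) + dt + K * dv + dt * (K * `|grid dv j|).
Proof.
move=> dt_dv Nt0; rewrite ler_norml; apply/andP; split; last first.
  by have := scheme_le_hopf_lax i j Nt0; lra.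
set v := grid dv j; set W := hopf_lax _ _ _ _.
have e1 : 0 <= t_ Nt * K * (dx / dt).
  by rewrite !mulr_ge0// ?invr_ge0 ltW.
have e2 : 0 <= t_ Nt * K * dv by rewrite !mulr_ge0// ltW.
have e3 : 0 <= K * dv by rewrite mulr_ge0// ltW.
have e4 : 0 <= dt * (K * `|v|) by rewrite !mulr_ge0// ltW.
have M0 : 0 <= M by apply: le_trans (phi_bound 0 0).
have B0 : 0 <= v ^+ 2 / 2 + 2 * M + t_ Nt.
  by have := sqr_ge0 v; have := t_ge0 Nt; lra.
have dt0' := dt0.
suff : W <= phi Nt i j + c * (v ^+ 2 / 2 + 2 * M + t_ Nt) + t_ Nt * K * (dx / dt) + dt.
  by lra.
have [c1|c1] := leP c 1.
  have := hopf_lax_le_scheme i j dt_dv c1 Nt0; rewrite -/v -/W.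
  by have := mulr_ge0 c_ge0 (t_ge0 Nt); lra.
have := hopf_lax_ub _ _ phi_bound (t_ Nt) (grid dx i) v (t_ge0 Nt); rewrite -/W.
have := phi_lb Nt i j (leqnn _).
have := ler_peMl B0 (ltW c1).
by lra.
Qed.

End Scheme.

(** * Error estimate *)

Theorem theorem2p2 (R : realType) (T : R) (phi_in : R -> R -> R) :
  0 < T ->
  exists C : R -> R,
    forall (Nt : nat) (dt dx dv : R),
      (0 < Nt)%N -> dt = T / Nt%:R -> 0 < dx -> 0 < dv ->
      dt <= dv ^+ 2 / 2 ->
    forall (mu_in : int -> R), is_mu_in dt dx dv phi_in mu_in ->
    forall (M L : R), 0 < M -> 0 <= L ->
      (forall x v : R, `|phi_in x v - v ^+ 2 / 2| <= M) ->
      (forall (i : int) (eps : R), 0 < eps <= 1 ->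
         `|mu_in i + eps * ln (c_eps dv eps)| <= M) ->
      (forall v : R, L.-lipschitz (fun x : R => phi_in x v - v ^+ 2 / 2)) ->
      (forall x : R, L.-lipschitz (fun v : R => phi_in x v - v ^+ 2 / 2)) ->
    forall (mu : nat -> int -> R) (phi : nat -> int -> int -> R),
      is_scheme_solution Nt dt dx dv phi_in mu_in mu phi ->
    forall i j : int,
      `|phi Nt i j - hopf_lax phi_in T (grid dx i) (grid dv j)|
        <= C (grid dv j) * (dt + dx / dt + dv).
Proof.
move=> T0.
pose data (M L : R) := [/\ 0 < M, 0 <= L,
  forall x v : R, `|phi_in x v - v ^+ 2 / 2| <= M,
  forall v : R, L.-lipschitz (fun x : R => phi_in x v - v ^+ 2 / 2) &
  forall x : R, L.-lipschitz (fun v : R => phi_in x v - v ^+ 2 / 2)].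
have [[M [L [M0 L0 phi_bound lipx lipv]]]|no_data] :=
  pselect (exists M L, data M L); last first.
  exists (fun=> 0) => Nt dt dx dv _ _ _ _ _ mu_in _ M L M0 L0 bnd _ lipx lipv.
  by case: no_data; exists M, L.
(* L may vanish; a positive Lipschitz constant makes 1/K meaningful. *)
pose K := L + 1; have K0 : 0 < K by rewrite ltr_wpDl.
have phi_lipx v x y : phi_in x v <= phi_in y v + K * `|x - y|.
  have := lipx v (x, y) (conj I I) => /=; rewrite /K.
  have := ler_norm (phi_in x v - v ^+ 2 / 2 - (phi_in y v - v ^+ 2 / 2)).
  by have := normr_ge0 (x - y); lra.
have phi_lipv x v w : `|v| <= `|w| -> phi_in x v <= phi_in x w + K * `|v - w|.
  move=> vw; have := lipv x (v, w) (conj I I) => /=; rewrite /K.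
  have := ler_norm (phi_in x v - v ^+ 2 / 2 - (phi_in x w - w ^+ 2 / 2)).
  have : v ^+ 2 <= w ^+ 2.
    rewrite -[v ^+ 2]real_normK ?num_real// -[w ^+ 2]real_normK ?num_real//.
    by rewrite lerXn2r// nnegrE.
  by have := normr_ge0 (v - w); lra.
exists (fun v => 2 * K ^+ 2 * (v ^+ 2 / 2 + 2 * M + T) + T * K + 1 + K + K * `|v|).
move=> Nt dt dx dv Nt0 dtE dx0 dv0 dt_dv mu_in _ _ _ _ _ _ _ _ _ mu phi sol i j.
have NtR : 0 < Nt%:R :> R by rewrite ltr0n.
have dt0 : 0 < dt by rewrite dtE divr_gt0.
have TE : T = Nt%:R * dt by rewrite dtE mulrC divfK// gt_eqF.
have := scheme_error _ _ _ phi_bound phi_lipx K0 _ _ _ _ _ _ _ dt0 dx0 dv0 sol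
  phi_lipv i j dt_dv Nt0.
rewrite -TE => /le_trans; apply; set v := grid dv j; set r := dx / dt.
have r0 : 0 <= r by rewrite divr_ge0// ltW.
pose a := 2 * K ^+ 2 * (v ^+ 2 / 2 + 2 * M + T).
have a0 : 0 <= a.
  rewrite mulr_ge0//; first by rewrite mulr_ge0// sqr_ge0.
  by have := sqr_ge0 v; lra.
have b0 : 0 <= T * K := mulr_ge0 (ltW T0) (ltW K0).
have d0 : 0 <= K * `|v| := mulr_ge0 (ltW K0) (normr_ge0 v).
have rv0 : 0 <= r + dv := addr_ge0 r0 (ltW dv0).
have dv0' := ltW dv0; have dt0' := ltW dt0; have K0' := ltW K0.
have := mulr_ge0 a0 rv0; have := mulr_ge0 b0 dt0'; have := mulr_ge0 d0 rv0.
have := mulr_ge0 K0' (addr_ge0 r0 dt0'); rewrite /a; lra.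
Qed.
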